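(* Let $A\in\mathbb{R}^{m\times n}$ with $m\ge n$, let $[a,b]\subset[\sigma_{\min}(A),\|A\|]$, let $P$ be the Chebyshev--Jackson approximate spectral projector of degree $d$ of $S=A^TA$ for $[a,b]$ with eigenpairs $(\gamma_i,v_i)$, and let $n_{sv}\le p<n$. Let $\hat V^{(0)}\in\mathbb{R}^{n\times p}$ have orthonormal columns, with $V_p^T\hat V^{(0)}$ invertible and $\gamma_p>\gamma_{p+1}$, and let $Q_1^{(k)}$ and the Ritz triplets $(\hat\sigma_i^{(k)},\hat u_i^{(k)},\hat v_i^{(k)})$, $1\le i\le p$, $k\ge1$, be generated by the CJ-FEAST SVDsolver. Let $\beta^{(k)}=\|P^{(k)}S(I-P^{(k)})\|$, where $P^{(k)}$ is the orthogonal projector onto $\mathrm{span}\{Q_1^{(k)}\}$. Assume that each singular value of $A$ in $[a,b]$ is simple, and define $$\delta_i^{(k)}=\min_{j\ne i}|\sigma_i^2-(\hat\sigma_j^{(k)})^2|,\qquad i=1,2,\ldots,n_{sv}$$ (the minimum over $1\le j\le p$, $j\neq i$). Let $E^{(0)}=V_{p,\perp}^T\hat V^{(0)}(V_p^T\hat V^{(0)})^{-1}$. Then for $i=1,2,\dots,n_{sv}$ (whenever $\delta_i^{(k)}>0$ in the first bound and $\hat\sigma_i^{(k)}>0$ in the second, so that the right-hand sides are defined) $$\sin\angle(\hat v_i^{(k)},v_i)\le\sqrt{1+\frac{(\beta^{(k)})^2}{(\delta_i^{(k)})^2}}\left(\frac{\gamma_{p+1}}{\gamma_i}\right)^k\|E^{(0)}\|,$$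 $$\sin\angle(\hat u_i^{(k)},u_i)\le\frac{\|A\|}{\hat\sigma_i^{(k)}}\sin\angle(\hat v_i^{(k)},v_i),$$ $$|(\hat\sigma_i^{(k)})^2-\sigma_i^2|\le\|A\|^2\sin^2\angle(\hat v_i^{(k)},v_i).$$
   Context: $\|\cdot\|$ is the 2-norm (spectral norm for matrices); $\mathrm{span}\{X\}$ is the column space of $X$; $\angle(x,y)\in[0,\pi/2]$ is the acute angle between the lines spanned by $x$ and $y$. Approximate projector. With $\sigma_{\min}=\sigma_{\min}(A)$ let $l(x)=\frac{2x-\|A\|^2-\sigma_{\min}^2}{\|A\|^2-\sigma_{\min}^2}$, $\alpha=\arccos(l(a^2))$, $\beta=\arccos(l(b^2))$. Let $\psi_d(x)=\frac{c_0}{2}+\sum_{j=1}^d\rho_{j,d}c_jT_j(x)$ with $T_j$ the Chebyshev polynomials of the first kind, $c_0=\frac2\pi(\alpha-\beta)$, $c_j=\frac2\pi\frac{\sin(j\alpha)-\sin(j\beta)}{j}$ for $j\ge1$, and $\rho_{j,d}=\frac{(d+2-j)\sin(\frac{\pi}{d+2})\cos(\frac{j\pi}{d+2})+\cos(\frac{\pi}{d+2})\sin(\frac{j\pi}{d+2})}{(d+2)\sin\frac{\pi}{d+2}}$. Then $P=\psi_d(l(S))$, a symmetric matrix whose eigenvalues $\gamma_i=\psi_d(l(\sigma_i^2))$ lie in $[0,1]$. Labeling. $(\sigma_i,u_i,v_i)$, $i=1,\dots,n$, are the singular triplets of $A$ ($Av_i=\sigma_iu_i$, $A^Tu_i=\sigma_iv_i$,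 with the $u_i$ orthonormal and the $v_i$ orthonormal; $Pv_i=\gamma_iv_i$), labeled so that $\sigma_1,\dots,\sigma_{n_{sv}}$ are exactly the singular values in $[a,b]$ and $\gamma_1\ge\gamma_2\ge\cdots\ge\gamma_n$. Put $V_p=[v_1,\dots,v_p]$, $V_{p,\perp}=[v_{p+1},\dots,v_n]$. CJ-FEAST SVDsolver. For $k=1,2,\dots$: compute $Y^{(k)}=P\hat V^{(k-1)}$; thin QR factorizations $Y^{(k)}=Q_1^{(k)}R_1^{(k)}$ and $AQ_1^{(k)}=Q_2^{(k)}\bar A^{(k)}$ with $Q_1^{(k)}\in\mathbb{R}^{n\times p}$, $Q_2^{(k)}\in\mathbb{R}^{m\times p}$ having orthonormal columns; the SVD $\bar A^{(k)}=\bar U^{(k)}\hat\Sigma^{(k)}(\bar V^{(k)})^T$ with $\hat\Sigma^{(k)}=\mathrm{diag}(\hat\sigma_1^{(k)},\dots,\hat\sigma_p^{(k)})$; and set $\hat U^{(k)}=Q_2^{(k)}\bar U^{(k)}$, $\hat V^{(k)}=Q_1^{(k)}\bar V^{(k)}$. The vectors $\hat u_i^{(k)}$, $\hat v_i^{(k)}$ are the $i$-th columns of $\hat U^{(k)}$, $\hat V^{(k)}$, and the Ritz triplets are labeled so that $\hat\sigma_1^{(k)},\dots,\hat\sigma_p^{(k)}$ are in the same order as $\sigma_1,\dots,\sigma_p$ (i.e. $\hat\sigma_i^{(k)}\le\hat\sigma_j^{(k)}$ whenever $\sigma_i<\sigma_j$). *)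

(* Defs.v *)
From HB Require Import structures.
From mathcomp Require Export all_boot all_order all_algebra.
From mathcomp Require Export all_classical all_reals all_analysis.

Set Implicit Arguments.
Unset Strict Implicit.
Unset Printing Implicit Defensive.
Import Order.TTheory GRing.Theory Num.Theory.
Local Open Scope classical_set_scope.
Local Open Scope ring_scope.

Section EuclideanGeometry.
Variable R : realType.

Definition inner (n : nat) (x y : 'cV[R]_n) : R := \sum_(i < n) x i 0 * y i 0.

(* The norm `|M| that the library puts on matrices is the max-norm, hence the
   2-norm and the spectral norm are defined here. *)
Definition norm2 (n : nat) (x : 'cV[R]_n) : R := Num.sqrt (inner x x).

Definition specnorm (m n : nat) (M : 'M[R]_(m, n)) : R :=
  sup [set norm2 (M *m x) | x in [set x : 'cV[R]_n | norm2 x <= 1]].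

Definition angle (n : nat) (x y : 'cV[R]_n) : R :=
  acos (`|inner x y| / (norm2 x * norm2 y)).

Definition orthonormal_cols (m n : nat) (M : 'M[R]_(m, n)) : Prop :=
  M^T *m M = 1%:M.

(* (_ == _)%MS compares row spaces, hence the transposes. *)
Definition orth_projector_onto (n p : nat)
    (Pi : 'M[R]_n) (X : 'M[R]_(n, p)) : Prop :=
  [/\ Pi^T = Pi, Pi *m Pi = Pi & (Pi^T == X^T)%MS].

Definition singular_triplet (m n : nat) (A : 'M[R]_(m, n))
    (s : R) (u : 'cV[R]_m) (v : 'cV[R]_n) : Prop :=
  [/\ 0 <= s, norm2 u = 1, norm2 v = 1, A *m v = s *: u & A^T *m u = s *: v].

(* For m < n the kernel of A need not be seen by this definition; it is used
   only for n <= m. *)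
Definition sigma_min (m n : nat) (A : 'M[R]_(m, n)) : R :=
  inf [set s | exists u v, singular_triplet A s u v].

Record svd_triplets (m n : nat) (A : 'M[R]_(m, n)) (sigma : 'I_n -> R)
    (U : 'M[R]_(m, n)) (V : 'M[R]_n) : Prop := SVDTriplets {
  svd_ge0 : forall i, 0 <= sigma i;
  svd_U : orthonormal_cols U;
  svd_V : orthonormal_cols V;
  svd_AV : forall i, A *m col i V = sigma i *: col i U;
  svd_AtU : forall i, A^T *m col i U = sigma i *: col i V }.

End EuclideanGeometry.

Section ApproximateProjector.
Variable R : realType.

Fixpoint chebyshevT_pair (j : nat) : {poly R} * {poly R} :=
  if j is j'.+1 then
    let: (t, t') := chebyshevT_pair j' in (t', 2%:R *: ('X * t') - t)
  else (1, 'X).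

(* First kind: T_0 = 1, T_1 = X, T_(j+2) = 2 X T_(j+1) - T_j. *)
Definition chebyshevT (j : nat) : {poly R} := (chebyshevT_pair j).1.

(* c_0 is stored undivided: the factor 1/2 is applied in cj_poly. *)
Definition cheb_coef (alpha beta : R) (j : nat) : R :=
  if j == 0%N then 2 / pi * (alpha - beta)
  else 2 / pi * ((sin (j%:R * alpha) - sin (j%:R * beta)) / j%:R).

Definition jackson_coef (j d : nat) : R :=
  let N : R := (d + 2)%:R in
  ((N - j%:R) * sin (pi / N) * cos (j%:R * pi / N)
   + cos (pi / N) * sin (j%:R * pi / N)) / (N * sin (pi / N)).

Definition cj_poly (alpha beta : R) (d : nat) : {poly R} :=
  (cheb_coef alpha beta 0 / 2)%:P
  + \sum_(1 <= j < d.+1)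
      (jackson_coef j d * cheb_coef alpha beta j) *: chebyshevT j.

Definition cj_affine (m n : nat) (A : 'M[R]_(m, n)) : {poly R} :=
  (specnorm A ^+ 2 - sigma_min A ^+ 2)^-1
    *: (2%:R *: 'X - (specnorm A ^+ 2 + sigma_min A ^+ 2)%:P).

Definition cj_psi (m n : nat) (A : 'M[R]_(m, n)) (a b : R) (d : nat)
    : {poly R} :=
  cj_poly (acos (cj_affine A).[a ^+ 2]) (acos (cj_affine A).[b ^+ 2]) d.

(* The size is n.+1 because horner_mx is only defined on the rings 'M_n.+1. *)
Definition cj_projector (m n : nat) (A : 'M[R]_(m, n.+1)) (a b : R) (d : nat)
    : 'M[R]_n.+1 :=
  horner_mx (A^T *m A) (cj_psi A a b d \Po cj_affine A).

End ApproximateProjector.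

Section Solver.
Variable R : realType.

Record thin_qr (m p : nat) (Y Q : 'M[R]_(m, p)) (T : 'M[R]_p) : Prop :=
  ThinQR {
    qr_eq : Y = Q *m T;
    qr_orth : orthonormal_cols Q;
    qr_upper : forall i j : 'I_p, (j < i)%N -> T i j = 0 }.

(* One pass through the loop of the solver for A with approximate projector P,
   starting from Vprev. *)
Record cj_feast_step (m n p : nat) (A : 'M[R]_(m, n)) (P : 'M[R]_n)
    (Vprev Y Q1 : 'M[R]_(n, p)) (R1 : 'M[R]_p)
    (Q2 : 'M[R]_(m, p)) (Abar Ubar : 'M[R]_p) (shat : 'I_p -> R)
    (Vbar : 'M[R]_p) (Uhat : 'M[R]_(m, p)) (Vhat : 'M[R]_(n, p)) : Prop :=
  CJFeastStep {
    step_Y : Y = P *m Vprev;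
    step_qr1 : thin_qr Y Q1 R1;
    step_qr2 : thin_qr (A *m Q1) Q2 Abar;
    step_svd : Abar = Ubar *m diag_mx (\row_i shat i) *m Vbar^T;
    step_shat : forall i, 0 <= shat i;
    step_Ubar : orthonormal_cols Ubar;
    step_Vbar : orthonormal_cols Vbar;
    step_Uhat : Uhat = Q2 *m Ubar;
    step_Vhat : Vhat = Q1 *m Vbar }.

(* The minimum over the empty set (p = 1) is +oo, whose inverse is 0. *)
Definition ritz_gap (p : nat) (s : R) (shat : 'I_p -> R) (i : 'I_p) : \bar R :=
  \big[Order.min/+oo%E]_(j < p | j != i) (`|s ^+ 2 - shat j ^+ 2|)%:E.

Definition first_cols (n p : nat) (hp : (p <= n)%N) (V : 'M[R]_n)
    : 'M[R]_(n, p) := colsub (widen_ord hp) V.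

Definition last_cols (n p : nat) (hp : (p <= n)%N) (V : 'M[R]_n)
    : 'M[R]_(n, n - p) :=
  colsub (fun j : 'I_(n - p) => cast_ord (subnKC hp) (rshift p j)) V.

End Solver.

(* Main.v *)
From mathcomp Require Import ring lra.
Require Import Defs.
Import Order.TTheory GRing.Theory Num.Theory.
Import numFieldNormedType.Exports.
Set Implicit Arguments.
Unset Strict Implicit.
Unset Printing Implicit Defensive.
Local Open Scope ring_scope.

(** CJ-FEAST is subspace iteration with [P], followed by Rayleigh–Ritz extraction
    from the iterated space; the three bounds separate these two effects.

    The iteration brings the eigenvector [v_i] close to the space. Applying [P ^+ k]
    to the combination [v_i + V_perp E0 e_i] of the starting columns and dividing by
    [gamma_i ^+ k] keeps [v_i] and damps the rest by
    [(gamma_(p+1) / gamma_i) ^+ k], so the distance from [v_i] to the k-th space is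
    at most that factor times [specnorm E0] ([subspace_iteration_residual]). This
    needs the trailing eigenvalues of [P] to be bounded in modulus by
    [gamma_(p+1)], that is, the eigenvalues to be nonnegative, and this is a
    property of the Jackson damping.

    Extraction loses little. The step makes the columns of [Vhat k] Ritz vectors of
    [S = A^T A] with Ritz values [shat i ^+ 2], and the component of [v_i] along the
    wrong Ritz vectors is controlled by its distance to the space, by the coupling
    [betak] and by the gap ([ritz_vector_bound]). The other two bounds do not
    involve the iteration: they compare the exact triplet with any unit [vh], [uh]
    such that [A vh = s uh] ([left_vector_bound], [ritz_value_bound]).

    Nonnegativity of the eigenvalues ([cj_eigenvalue_ge0]) goes as follows. The
    Jackson factors are the normalized autocorrelations of a sine window
    ([jackson_coef_autocorr]), so the Jackson kernel
    [1 + 2 \sum_j rho_j cos (j t)] is a multiple of the squared modulus of a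
    trigonometric polynomial ([autocorr_fejer]). The value of [psi_d] at [cos t] is
    the integral of this kernel over an arc of positive orientation: the increment
    from [beta] to [alpha >= beta] of a primitive ([cj_poly_primitive]) whose
    derivative is a sum of two kernel values ([cj_primitive_nondecreasing]). *)

(** * Positivity of the Jackson kernel *)

Definition autocorr (R : realType) (s : nat -> R) (N j : nat) : R :=
  \sum_(k < N - j) s k * s (k + j)%N.

(** Enlarging the window by one entry adds exactly one product to each lag;
    this is what makes the next lemma an induction on the window length. *)
Lemma autocorr_recr (R : realType) (s : nat -> R) (N j : nat) : (j <= N)%N ->
  autocorr s N.+1 j = autocorr s N j + s (N - j)%N * s N.
Proof. by move=> jN; rewrite /autocorr subSn// big_ord_recr/= subnK. Qed.

(** The easy half of the Fejér–Riesz theorem: a cosine polynomial whose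
    coefficients are autocorrelations is the squared modulus of
    [\sum_k s k * exp (i k t)], hence nonnegative. *)
Lemma autocorr_fejer (R : realType) (s : nat -> R) (d : nat) (t : R) :
  autocorr s d.+1 0 + 2 * \sum_(j < d) autocorr s d.+1 j.+1 * cos (j.+1%:R * t)
  = (\sum_(k < d.+1) s k * cos (k%:R * t)) ^+ 2
    + (\sum_(k < d.+1) s k * sin (k%:R * t)) ^+ 2.
Proof.
elim: d => [|d IHd].
  rewrite /autocorr !big_ord1 big_ord0 mul0r cos0 sin0 /=; ring.
rewrite autocorr_recr // subn0.
under eq_bigr => j _.
  rewrite autocorr_recr; last exact: leq_trans (ltn_ord j) _.
  rewrite mulrDl; over.
rewrite big_split /= [\sum_(j < _) autocorr s d.+1 j.+1 * _]big_ord_recr /=.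
have -> : autocorr s d.+1 d.+1 = 0 by rewrite /autocorr subnn big_ord0.
rewrite [\sum_(j < _) s _ * s d.+1 * _](reindex_inj rev_ord_inj) /=.
under [X in _ * (_ + X)]eq_bigr => j _.
  have jd : (j <= d)%N by rewrite -ltnS.
  rewrite !subSS subKn // -subSn // natrB ?leqW //.
  rewrite mulrBl cosB.
  have -> : s j * s d.+1 * (cos (d.+1%:R * t) * cos (j%:R * t) +
       sin (d.+1%:R * t) * sin (j%:R * t)) =
     s d.+1 * cos (d.+1%:R * t) * (s j * cos (j%:R * t))
     + s d.+1 * sin (d.+1%:R * t) * (s j * sin (j%:R * t)) by ring.
  over.
rewrite big_split /= -!mulr_sumr.
rewrite [in RHS]big_ord_recr /= [X in _ + X ^+ 2]big_ord_recr /=.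
move: IHd.
set X := \sum_(k < d.+1) _; set Y := \sum_(k < d.+1) _; set Z := \sum_(k < d) _.
move=> IHd; rewrite mul0r addr0.
have cs := cos2Dsin2 (d.+1%:R * t).
transitivity (autocorr s d.+1 0 + 2 * Z
  + (cos (d.+1%:R * t) ^+ 2 + sin (d.+1%:R * t) ^+ 2) * s d.+1 ^+ 2
  + 2 * (s d.+1 * cos (d.+1%:R * t) * X + s d.+1 * sin (d.+1%:R * t) * Y)).
  rewrite cs; ring.
rewrite IHd; ring.
Qed.

(** The sine window on [d + 1] points, which vanishes at the two neighbouring
    points [k = -1] and [k = d + 1]; its trigonometric polynomial generates the
    Jackson kernel. *)
Definition jackson_window (R : realType) (d k : nat) : R :=
  sin (k.+1%:R * (pi / (d + 2)%:R)).

(** The sum telescopes, since [2 sin phi cos x = sin (x + phi) - sin (x - phi)]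
    and consecutive angles differ by [2 phi]. *)
Lemma sum_cos_arith (R : realType) (c phi : R) (M : nat) :
  2 * sin phi * \sum_(k < M) cos ((c + 2 * k%:R) * phi)
  = sin ((c + 2 * M%:R - 1) * phi) - sin ((c - 1) * phi).
Proof.
elim: M => [|M IHM]; first by rewrite big_ord0 !mulr0 addr0 subrr.
rewrite big_ord_recr /= mulrDr IHM -[M.+1]addn1 natrD.
have -> : (c + 2 * (M%:R + 1) - 1) * phi = (c + 2 * M%:R) * phi + phi by ring.
have -> : (c + 2 * M%:R - 1) * phi = (c + 2 * M%:R) * phi - phi by ring.
rewrite sinB sinD; ring.
Qed.

Lemma jackson_angle_gt0 (R : realType) (d : nat) :
  0 < sin (pi / (d + 2)%:R : R).
Proof.
apply: sin_gt0_pi; rewrite divr_gt0 ?pi_gt0 ?ltr0n ?addn2 //=.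
by rewrite gtr_pMr ?pi_gt0// invf_lt1 ?ltr0n // ltr1n.
Qed.

(** The identity behind the Jackson damping factors: they are, up to
    normalization, the autocorrelations of the sine window. Each product of sines
    is half a difference of cosines, one of them independent of [k], and the
    others form the sum of [sum_cos_arith]. Its last angle closes up because
    [(d + 2) * phi = pi]. *)
Lemma jackson_coef_autocorr (R : realType) (d j : nat) : (j <= d.+1)%N ->
  jackson_coef R j d = 2 / (d + 2)%:R * autocorr (jackson_window R d) d.+1 j.
Proof.
move=> jd; have sphi := jackson_angle_gt0 R d.
have N0 : (d + 2)%:R != 0 :> R by rewrite pnatr_eq0 addn2.
rewrite /jackson_coef /autocorr /jackson_window.
set N : R := (d + 2)%:R in sphi N0 *; set phi := pi / N in sphi *.
have prodE (k : nat) : sin (k.+1%:R * phi) * sin ((k + j).+1%:R * phi)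
    = (cos (j%:R * phi) - cos ((j%:R + 2 + 2 * k%:R) * phi)) / 2.
  have -> : j%:R * phi = (k + j).+1%:R * phi - k.+1%:R * phi.
    by rewrite -addSn natrD; ring.
  have -> : (j%:R + 2 + 2 * k%:R) * phi = (k + j).+1%:R * phi + k.+1%:R * phi.
    by rewrite -addSn natrD -[k.+1]addn1 natrD; ring.
  by rewrite cosB cosD; field.
under eq_bigr => k _ do rewrite prodE.
rewrite -mulr_suml sumrB sumr_const card_ord -[cos _ *+ _]mulr_natl natrB //.
have := sum_cos_arith (j%:R + 2) phi (d.+1 - j); rewrite natrB //.
set C := \sum_(k < _) _.
have Nphi : N * phi = pi by rewrite /phi mulrC divfK.
have NE : N = d.+1%:R + 1 by rewrite /N addn2 -natr1.
have -> : (j%:R + 2 + 2 * (d.+1%:R - j%:R) - 1) * phi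
   = - ((j%:R + 1) * phi) + pi *+ 2.
  by rewrite -Nphi NE; ring.
rewrite sinD2pi sinN.
have -> : (j%:R + 2 - 1) * phi = (j%:R + 1) * phi by ring.
rewrite [(j%:R + 1) * phi]mulrDl mul1r sinD => hC.
have -> : C = - (sin (j%:R * phi) * cos phi + cos (j%:R * phi) * sin phi)
                / sin phi.
  apply: (mulfI (x := 2 * sin phi)); first by rewrite mulf_neq0 // gt_eqF.
  rewrite hC; field; exact: lt0r_neq0.
have -> : j%:R * pi / N = j%:R * phi by rewrite mulrA.
have -> : d.+1%:R = N - 1 by rewrite NE addrK.
by clearbody phi N; field; rewrite N0 lt0r_neq0.
Qed.

Lemma jackson_kernel_ge0 (R : realType) (d : nat) (t : R) :
  0 <= 1 + 2 * \sum_(j < d) jackson_coef R j.+1 d * cos (j.+1%:R * t).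
Proof.
have sphi := jackson_angle_gt0 R d.
have N0 : (d + 2)%:R != 0 :> R by rewrite pnatr_eq0 addn2.
have jackson0 : jackson_coef R 0 d = 1.
  rewrite /jackson_coef !mul0r cos0 sin0 subr0 mulr1 mulr0 addr0 divff //.
  by rewrite mulf_neq0 // lt0r_neq0.
rewrite -[X in X + _]jackson0 jackson_coef_autocorr //.
under eq_bigr => j _.
  rewrite jackson_coef_autocorr; last exact: leqW.
  rewrite -[_ * cos _]mulrA; over.
rewrite -mulr_sumr mulrCA -mulrDr autocorr_fejer.
by rewrite mulr_ge0 ?divr_ge0 // addr_ge0 // sqr_ge0.
Qed.

(** * Nonnegativity of the Chebyshev–Jackson polynomial *)

Lemma chebyshevT_cos (R : realType) (j : nat) (t : R) :
  (chebyshevT R j).[cos t] = cos (j%:R * t).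
Proof.
suff [] : (chebyshevT_pair R j).1.[cos t] = cos (j%:R * t)
  /\ (chebyshevT_pair R j).2.[cos t] = cos (j.+1%:R * t) by [].
elim: j => [|j IHj] /=; first by rewrite !hornerE cos0.
case: (chebyshevT_pair R j) IHj => T T' /= [hT hT']; split => //.
rewrite hornerD hornerN hornerZ hornerM hornerX hT hT'.
rewrite -[j.+2]addn1 -[j.+1]addn1 !natrD.
have -> : (j%:R + 1 + 1) * t = (j%:R + 1) * t + t by ring.
have -> : j%:R * t = (j%:R + 1) * t - t by ring.
rewrite cosB cosD; ring.
Qed.

(** A primitive in [x] of
    [(1 + 2 \sum_(1 <= j <= d) rho_j cos (j t) cos (j x)) / pi]. *)
Definition cj_primitive (R : realType) (d : nat) (t x : R) : R :=
  pi^-1 * x + \sum_(j < d)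
    2 / pi * jackson_coef R j.+1 d * cos (j.+1%:R * t) / j.+1%:R
    * sin (j.+1%:R * x).

(** [psi_d (cos t)] is the integral of the Jackson kernel over an arc; computing the
    integral termwise turns it into a difference of two values of one primitive,
    so that only a derivative, and no integral, has to be handled. *)
Lemma cj_poly_primitive (R : realType) (d : nat) (alpha beta t : R) :
  (cj_poly alpha beta d).[cos t]
  = cj_primitive d t alpha - cj_primitive d t beta.
Proof.
have pi0 : pi != 0 :> R by rewrite lt0r_neq0 ?pi_gt0.
rewrite /cj_poly big_add1 big_mkord /= hornerD hornerC horner_sum.
rewrite /cj_primitive opprD addrACA -mulrBr -sumrB; congr (_ + _).
  (* pi is itself a multiple x *+ 2, which field would open; hence a variable. *)
  by rewrite /cheb_coef /=; move: (pi) pi0 => q q0; field.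
apply: eq_bigr => j _; rewrite hornerZ chebyshevT_cos /cheb_coef /=.
have j0 : j.+1%:R != 0 :> R by rewrite pnatr_eq0.
by move: (pi) pi0 (j.+1%:R) j0 => q q0 c c0; field; rewrite q0 c0.
Qed.

Lemma is_derive_cj_primitive (R : realType) (d : nat) (t x : R) :
  is_derive x 1 (cj_primitive d t) (pi^-1 + \sum_(j < d)
    2 / pi * jackson_coef R j.+1 d * cos (j.+1%:R * t) * cos (j.+1%:R * x)).
Proof.
have -> : cj_primitive d t = (pi^-1 \*: id) + \sum_(j < d)
   ((2 / pi * jackson_coef R j.+1 d * cos (j.+1%:R * t) / j.+1%:R)
    \*: (sin \o (j.+1%:R \*: id))).
  by apply/funext => y; rewrite /cj_primitive fctE /= fct_sumE.
have dlin (c : R) : is_derive x 1 (c \*: id) c.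
  rewrite -[X in is_derive _ _ _ X]mulr1.
  exact: (is_deriveZ c (is_derive_id x 1)).
apply: is_deriveD => //; apply: is_derive_sum => j.
set c := _ / j.+1%:R.
have -> : 2 / pi * jackson_coef R j.+1 d * cos (j.+1%:R * t) * cos (j.+1%:R * x)
    = c * (cos (j.+1%:R * x) * j.+1%:R).
  by rewrite /c [RHS]mulrACA mulVf ?mulr1 // pnatr_eq0.
exact: (is_deriveZ c (is_derive1_comp (is_derive_sin _) (dlin _))).
Qed.

(** By the product formula for cosines, the derivative at [z] is the sum of the
    Jackson kernels at [t - z] and [t + z], divided by [2 pi]. *)
Lemma cj_primitive_nondecreasing (R : realType) (d : nat) (t : R) :
  {homo cj_primitive d t : x y / x <= y}.
Proof.
move=> x y xy; have dF := is_derive_cj_primitive d t.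
apply: (@ger0_derive1_ndecr R (cj_primitive d t) x y) => // [z _|].
  rewrite derive1E; have [_ ->] := dF z.
  have -> : pi^-1 + \sum_(j < d)
      2 / pi * jackson_coef R j.+1 d * cos (j.+1%:R * t) * cos (j.+1%:R * z)
    = (1 + 2 * \sum_(j < d) jackson_coef R j.+1 d * cos (j.+1%:R * (t - z))
    + (1 + 2 * \sum_(j < d) jackson_coef R j.+1 d * cos (j.+1%:R * (t + z))))
      / (2 * pi).
    rewrite addrACA -mulrDr -big_split /=.
    under [in RHS]eq_bigr => j _.
      rewrite mulrBr mulrDr cosB cosD.
      have -> (u v c : R) : c * (u + v) + c * (u - v) = 2 * c * u by ring.
      over.
    have pi0 : pi != 0 :> R by rewrite lt0r_neq0 ?pi_gt0.
    rewrite [RHS]mulrDl; congr (_ + _).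
      by move: (pi) pi0 => q q0; field.
    rewrite mulr_sumr mulr_suml; apply: eq_bigr => j _.
    by move: (pi) pi0 => q q0; field.
  apply: divr_ge0; last by rewrite mulr_ge0 ?pi_ge0.
  by apply: addr_ge0; exact: jackson_kernel_ge0.
by apply: derivable_within_continuous => z _; have [] := dF z.
Qed.

Lemma acos_nonincreasing (R : realType) (x y : R) :
  -1 <= x -> x <= y -> y <= 1 -> acos y <= acos x.
Proof.
move=> x1 xy y1.
have xr : -1 <= x <= 1 by rewrite x1 (le_trans xy).
have yr : -1 <= y <= 1 by rewrite y1 (le_trans x1).
rewrite leNgt; apply/negP => lt_acos.
have := ltr_cos (x := acos x) (y := acos y).
rewrite !in_itv /= !acos_ge0 ?acos_lepi //= => /(_ isT isT).
by rewrite lt_acos !acosK ?in_itv //= ltNge xy.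
Qed.

Lemma cj_poly_ge0 (R : realType) (d : nat) (alpha beta t : R) :
  beta <= alpha -> 0 <= (cj_poly alpha beta d).[cos t].
Proof.
by move=> ba; rewrite cj_poly_primitive subr_ge0; exact: cj_primitive_nondecreasing.
Qed.

(** * Euclidean and spectral norms, angles *)

Lemma innerE (R : realType) (n : nat) (x y : 'cV[R]_n) :
  inner x y = (x^T *m y) 0 0.
Proof. by rewrite mxE; apply: eq_bigr => i _; rewrite mxE. Qed.

Lemma innerC (R : realType) (n : nat) (x y : 'cV[R]_n) : inner x y = inner y x.
Proof. by apply: eq_bigr => i _; rewrite mulrC. Qed.

Lemma innerDr (R : realType) (n : nat) (x y z : 'cV[R]_n) :
  inner x (y + z) = inner x y + inner x z.
Proof. by rewrite !innerE mulmxDr mxE. Qed.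

Lemma innerZr (R : realType) (n : nat) (c : R) (x y : 'cV[R]_n) :
  inner x (c *: y) = c * inner x y.
Proof. by rewrite !innerE -scalemxAr mxE. Qed.

Lemma innerDl (R : realType) (n : nat) (x y z : 'cV[R]_n) :
  inner (x + y) z = inner x z + inner y z.
Proof. by rewrite ![inner _ z]innerC innerDr. Qed.

Lemma innerZl (R : realType) (n : nat) (c : R) (x y : 'cV[R]_n) :
  inner (c *: x) y = c * inner x y.
Proof. by rewrite ![inner _ y]innerC innerZr. Qed.

Lemma innerNr (R : realType) (n : nat) (x y : 'cV[R]_n) :
  inner x (- y) = - inner x y.
Proof. by rewrite -scaleN1r innerZr mulN1r. Qed.

Lemma innerNl (R : realType) (n : nat) (x y : 'cV[R]_n) :
  inner (- x) y = - inner x y.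
Proof. by rewrite innerC innerNr innerC. Qed.

Lemma inner_mulmxl (R : realType) (m n : nat) (M : 'M[R]_(m, n))
    (x : 'cV[R]_n) (y : 'cV[R]_m) : inner (M *m x) y = inner x (M^T *m y).
Proof. by rewrite !innerE trmx_mul mulmxA. Qed.

Lemma inner_ge0 (R : realType) (n : nat) (x : 'cV[R]_n) : 0 <= inner x x.
Proof. by apply: sumr_ge0 => i _; rewrite -expr2 sqr_ge0. Qed.

Lemma norm2_ge0 (R : realType) (n : nat) (x : 'cV[R]_n) : 0 <= norm2 x.
Proof. exact: sqrtr_ge0. Qed.

Lemma norm2_sqr (R : realType) (n : nat) (x : 'cV[R]_n) :
  norm2 x ^+ 2 = inner x x.
Proof. by rewrite sqr_sqrtr ?inner_ge0. Qed.

Lemma norm2Z (R : realType) (n : nat) (c : R) (x : 'cV[R]_n) :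
  norm2 (c *: x) = `|c| * norm2 x.
Proof.
by rewrite /norm2 innerZl innerZr mulrA -expr2 sqrtrM ?sqr_ge0 // sqrtr_sqr.
Qed.

Lemma norm2_eq0 (R : realType) (n : nat) (x : 'cV[R]_n) : norm2 x = 0 -> x = 0.
Proof.
move=> /eqP; rewrite sqrtr_eq0 => x0.
have /eqP : inner x x = 0 by apply/eqP; rewrite eq_le x0 inner_ge0.
rewrite psumr_eq0 => [/allP xi0|i _]; last by rewrite -expr2 sqr_ge0.
apply/colP => i; rewrite mxE.
have := xi0 i; rewrite mem_index_enum => /(_ isT); rewrite -expr2 sqrf_eq0.
by move/eqP.
Qed.

Lemma norm2_isometry (R : realType) (m n : nat) (Q : 'M[R]_(m, n))
    (x : 'cV[R]_n) : orthonormal_cols Q -> norm2 (Q *m x) = norm2 x.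
Proof. by move=> QQ; rewrite /norm2 inner_mulmxl mulmxA QQ mul1mx. Qed.

Lemma norm2_col (R : realType) (m n : nat) (Q : 'M[R]_(m, n)) (i : 'I_n) :
  orthonormal_cols Q -> norm2 (col i Q) = 1.
Proof.
move=> QQ; suff -> : col i Q = Q *m delta_mx i 0.
  rewrite norm2_isometry // /norm2 innerE trmx_delta mul_delta_mx mxE !eqxx.
  exact: sqrtr1.
by rewrite colE.
Qed.

Lemma cauchy_schwarz (R : realType) (n : nat) (x y : 'cV[R]_n) :
  inner x y ^+ 2 <= inner x x * inner y y.
Proof.
have [y0|] := eqVneq (inner y y) 0.
  have -> : y = 0 by apply: norm2_eq0; rewrite /norm2 y0 sqrtr0.
  by rewrite -(scale0r 0) !innerZr !mul0r mulr0 expr0n.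
rewrite neq_lt ltNge inner_ge0 /= => y0.
have := inner_ge0 (inner y y *: x - inner x y *: y).
have -> : inner (inner y y *: x - inner x y *: y)
    (inner y y *: x - inner x y *: y)
    = inner y y * (inner x x * inner y y - inner x y ^+ 2).
  rewrite !(innerDl, innerDr, innerNl, innerNr, innerZl, innerZr) (innerC y x).
  ring.
by rewrite pmulr_rge0 // subr_ge0.
Qed.

(** The Frobenius norm is such a constant, by Cauchy–Schwarz on each row. *)
Lemma norm2_mulmx_bounded (R : realType) (m n : nat) (M : 'M[R]_(m, n)) :
  exists C, forall x, norm2 (M *m x) <= C * norm2 x.
Proof.
exists (Num.sqrt (\sum_i inner (row i M)^T (row i M)^T)) => x.
rewrite -sqrtrM ?sumr_ge0 // => [|i _]; last exact: inner_ge0.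
apply: ler_wsqrtr; rewrite mulr_suml; apply: ler_sum => i _.
rewrite -expr2; have -> : (M *m x) i 0 = inner (row i M)^T x.
  by rewrite innerE trmxK -row_mul [RHS]mxE.
exact: cauchy_schwarz.
Qed.

(** [specnorm] is the supremum of this set, and a supremum of reals bounds its
    set only when the set is bounded. *)
Lemma specnorm_has_ubound (R : realType) (m n : nat) (M : 'M[R]_(m, n)) :
  has_ubound [set norm2 (M *m x) | x in [set x : 'cV[R]_n | norm2 x <= 1]]%classic.
Proof.
have [C hC] := norm2_mulmx_bounded M.
exists `|C| => _ [x /= x1 <-]; apply: le_trans (hC x) _.
apply: le_trans (ler_norm _) _; rewrite normrM (ger0_norm (norm2_ge0 x)).
by rewrite ler_piMr.
Qed.

Lemma norm2_mulmx_le (R : realType) (m n : nat) (M : 'M[R]_(m, n))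
    (x : 'cV[R]_n) : norm2 (M *m x) <= specnorm M * norm2 x.
Proof.
have [x0|] := eqVneq (norm2 x) 0.
  by rewrite x0 (norm2_eq0 x0) mulmx0 mulr0 /norm2 innerE mulmx0 mxE sqrtr0.
rewrite neq_lt ltNge norm2_ge0 /= => x0.
have {1}-> : x = norm2 x *: ((norm2 x)^-1 *: x).
  by rewrite scalerA divff ?scale1r // gt_eqF.
rewrite -scalemxAr norm2Z ger0_norm ?norm2_ge0 // mulrC ler_pM2r //.
apply: ub_le_sup; first exact: specnorm_has_ubound.
exists ((norm2 x)^-1 *: x) => //=.
by rewrite norm2Z ger0_norm ?invr_ge0 ?norm2_ge0 // mulVf // gt_eqF.
Qed.

Lemma specnorm_ge0 (R : realType) (m n : nat) (M : 'M[R]_(m, n)) :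
  0 <= specnorm M.
Proof.
apply: ub_le_sup; first exact: specnorm_has_ubound.
by exists 0; rewrite /= ?mulmx0 /norm2 innerE mulmx0 mxE sqrtr0 ?ler01.
Qed.

Lemma cos_angle_bounds (R : realType) (n : nat) (x y : 'cV[R]_n) :
  norm2 x = 1 -> norm2 y = 1 -> -1 <= `|inner x y| <= 1.
Proof.
move=> x1 y1; have cs := cauchy_schwarz x y.
rewrite -!norm2_sqr x1 y1 expr1n mul1r in cs.
rewrite (le_trans _ (normr_ge0 _)) ?lerN10 //=.
by rewrite -(ler_pXn2r (n := 2)) ?nnegrE // real_normK ?num_real ?expr1n.
Qed.

Lemma sin_angle_sqr (R : realType) (n : nat) (x y : 'cV[R]_n) :
  norm2 x = 1 -> norm2 y = 1 ->
  sin (angle x y) ^+ 2 = 1 - inner x y ^+ 2.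
Proof.
move=> x1 y1; have xy1 := cos_angle_bounds x1 y1.
rewrite /angle x1 y1 mul1r divr1 sin_acos // sqr_sqrtr real_normK ?num_real //.
have := cauchy_schwarz x y.
by rewrite -!norm2_sqr x1 y1 expr1n mul1r subr_ge0.
Qed.

Lemma sin_angle_ge0 (R : realType) (n : nat) (x y : 'cV[R]_n) :
  norm2 x = 1 -> norm2 y = 1 -> 0 <= sin (angle x y).
Proof.
move=> x1 y1; have xy1 := cos_angle_bounds x1 y1.
by rewrite /angle x1 y1 mul1r divr1 sin_acos // sqrtr_ge0.
Qed.

(** For unit vectors the sine is the distance to the line spanned by the other
    one; in this form it can be estimated through linear maps. *)
Lemma sin_angle_residual (R : realType) (n : nat) (x y : 'cV[R]_n) :
  norm2 x = 1 -> norm2 y = 1 ->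
  sin (angle x y) = norm2 (x - inner y x *: y).
Proof.
move=> x1 y1; apply/eqP.
rewrite -(eqrXn2 (n := 2)) ?norm2_ge0 ?sin_angle_ge0 //; apply/eqP.
rewrite sin_angle_sqr // norm2_sqr.
rewrite !(innerDl, innerDr, innerNl, innerNr, innerZl, innerZr) (innerC y x).
by rewrite -!norm2_sqr x1 y1; ring.
Qed.

(** * Orthogonal projections and Ritz vectors *)

Lemma orth_residual_sqr (R : realType) (n p : nat) (X : 'M[R]_(n, p))
    (x : 'cV[R]_n) : orthonormal_cols X ->
  inner (x - X *m (X^T *m x)) (x - X *m (X^T *m x))
  = inner x x - inner (X^T *m x) (X^T *m x).
Proof.
move=> XX; set c := X^T *m x.
have Xcx : inner (X *m c) x = inner c c by rewrite inner_mulmxl.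
have XcXc : inner (X *m c) (X *m c) = inner c c.
  by rewrite inner_mulmxl mulmxA XX mul1mx.
rewrite !(innerDl, innerDr, innerNl, innerNr) (innerC x) Xcx XcXc; ring.
Qed.

(** The orthogonal projection is the best approximation: the residual of [x] is
    the residual of [x - X *m c], and taking residuals contracts. *)
Lemma orth_residual_le (R : realType) (n p : nat) (X : 'M[R]_(n, p))
    (x : 'cV[R]_n) (c : 'cV[R]_p) : orthonormal_cols X ->
  norm2 (x - X *m (X^T *m x)) <= norm2 (x - X *m c).
Proof.
move=> XX; have -> : x - X *m (X^T *m x)
    = (x - X *m c) - X *m (X^T *m (x - X *m c)).
  rewrite mulmxBr mulmxA (mulmxA X^T) XX mul1mx mulmxBr !mulmxA.
  by rewrite opprB addrA addrNK.
by apply: ler_wsqrtr; rewrite orth_residual_sqr // gerBl inner_ge0.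
Qed.

(** Saad's bound for Ritz vectors. Let [c] hold the coordinates of the
    eigenvector [v] on the orthonormal basis [X] of Ritz vectors and let [r] be
    its residual. The eigenvalue equation, projected on the basis, reads
    [(lambda - theta j) * c j = (X^T S r) j]; so the components of [v] on the
    other Ritz vectors are controlled by [r], with the coupling norm in the
    numerator and the gap in the denominator. Adding [norm2 r ^+ 2] to them gives
    the squared sine. The factor [f] stands for the inverse square of the gap,
    which makes sense also when there is no other Ritz value. *)
Lemma ritz_vector_bound (R : realType) (n p : nat) (S : 'M[R]_n)
    (X : 'M[R]_(n, p)) (theta : 'I_p -> R) (lambda f : R) (v : 'cV[R]_n)
    (i : 'I_p) :
  orthonormal_cols X -> X^T *m S *m X = diag_mx (\row_j theta j) ->
  norm2 v = 1 -> S *m v = lambda *: v ->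
  0 <= f -> (forall j, j != i -> 1 <= f * (lambda - theta j) ^+ 2) ->
  sin (angle (col i X) v)
  <= Num.sqrt (1 + specnorm (X *m X^T *m S *m (1%:M - X *m X^T)) ^+ 2 * f)
     * norm2 (v - X *m (X^T *m v)).
Proof.
move=> XX XSX v1 Sv f0 gap.
set r := v - X *m (X^T *m v); set c := X^T *m v.
set beta := specnorm _.
have ci : inner (col i X) v = c i 0 by rewrite innerE tr_col -row_mul [LHS]mxE.
have rE : (1%:M - X *m X^T) *m r = r.
  rewrite /r mulmxBl mul1mx mulmxBr !mulmxA -(mulmxA X X^T X) XX mulmx1.
  by rewrite subrr subr0.
have coup : X^T *m S *m r = \col_j ((lambda - theta j) * c j 0).
  rewrite /r mulmxBr -(mulmxA _ S v) Sv -scalemxAr (mulmxA (X^T *m S) X) XSX -/c.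
  by apply/colP => j; rewrite mul_diag_mx !mxE mulrBl.
have coupLe : inner (X^T *m S *m r) (X^T *m S *m r) <= beta ^+ 2 * inner r r.
  rewrite -!norm2_sqr -exprMn ler_pXn2r ?nnegrE ?mulr_ge0 ?norm2_ge0 //;
    last exact: specnorm_ge0.
  rewrite -(norm2_isometry _ XX) -{1}rE !mulmxA; exact: norm2_mulmx_le.
have gapsum : inner c c - c i 0 ^+ 2 <= f * (beta ^+ 2 * inner r r).
  apply: le_trans (ler_wpM2l f0 coupLe); clearbody c.
  rewrite coup {1}/inner (bigD1 i) //= -expr2 addrAC subrr add0r.
  rewrite /inner [X in _ <= _ * X](bigD1 i) //= mulrDr.
  rewrite ler_wpDl //; first by rewrite mulr_ge0 // -expr2 sqr_ge0.
  rewrite mulr_sumr; apply: ler_sum => j ji; rewrite !mxE.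
  have -> : f * ((lambda - theta j) * c j 0 * ((lambda - theta j) * c j 0))
    = f * (lambda - theta j) ^+ 2 * (c j 0 ^+ 2) by ring.
  by rewrite -expr2 ler_peMl ?sqr_ge0 ?gap.
have pyth : inner r r = 1 - inner c c.
  by rewrite orth_residual_sqr // -(norm2_sqr v) v1 expr1n.
have X1 := norm2_col i XX.
rewrite -(ler_pXn2r (n := 2)) ?nnegrE ?sin_angle_ge0 ?mulr_ge0 ?norm2_ge0
  ?sqrtr_ge0 //.
have b0 : 0 <= 1 + beta ^+ 2 * f.
  by apply: addr_ge0; [exact: ler01 | exact: mulr_ge0 (sqr_ge0 _) f0].
rewrite sin_angle_sqr // ci exprMn sqr_sqrtr // norm2_sqr.
have -> : (1 + beta ^+ 2 * f) * inner r r
  = inner r r + f * (beta ^+ 2 * inner r r) by ring.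
apply: le_trans (lerD (lexx _) gapsum); rewrite pyth; lra.
Qed.

(** When [p = 1] the gap is [+oo] and its inverse [0], and there is no [j] to
    satisfy the second clause. *)
Lemma ritz_gap_inv (R : realType) (p : nat) (s : R) (shat : 'I_p -> R)
    (i : 'I_p) : (0 < ritz_gap s shat i)%E ->
  0 <= fine ((ritz_gap s shat i ^+ 2)^-1)%E /\
  forall j, j != i ->
    1 <= fine ((ritz_gap s shat i ^+ 2)^-1)%E * (s ^+ 2 - shat j ^+ 2) ^+ 2.
Proof.
have gap_le j : j != i -> (ritz_gap s shat i <= (`|s ^+ 2 - shat j ^+ 2|)%:E)%E.
  by move=> ji; rewrite /ritz_gap (bigD1 j) //= ge_min lexx.
move: gap_le; case: (ritz_gap s shat i) => [r||] // gap_le.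
  rewrite lte_fin => r0; rewrite -EFin_expe inver expf_eq0 /= gt_eqF //=.
  split=> [|j ji]; first by rewrite invr_ge0 sqr_ge0.
  have := gap_le j ji; rewrite lee_fin => rj.
  rewrite mulrC ler_pdivlMr ?exprn_gt0 // mul1r.
  rewrite -[X in _ <= X]real_normK ?num_real //.
  by rewrite ler_pXn2r ?nnegrE ?(ltW r0).
move=> _; split=> [|j ji]; last by have := gap_le j ji.
by rewrite expe2 mulyy invey.
Qed.

(** * Subspace iteration *)

Lemma sum_widen_split (R : realType) (n p : nat) (hp : (p <= n)%N)
    (F : 'I_n -> R) :
  \sum_j F j = \sum_(j < p) F (widen_ord hp j)
    + \sum_(j < n - p) F (cast_ord (subnKC hp) (rshift p j)).
Proof.
rewrite (reindex (cast_ord (subnKC hp))) /=; last first.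
  by exists (cast_ord (esym (subnKC hp))) => j _; rewrite ?cast_ordK ?cast_ordKV.
rewrite big_split_ord /=; congr (_ + _); apply: eq_bigr => j _.
by congr F; apply: val_inj.
Qed.

Lemma eigencoord_iter (R : realType) (n p : nat) (P V : 'M[R]_n)
    (gamma : 'I_n -> R) (k : nat) (Z : 'M[R]_(n, p)) (j : 'I_n) (i : 'I_p) :
  orthonormal_cols V -> (forall j, P *m col j V = gamma j *: col j V) ->
  (V^T *m iter k (mulmx P) Z) j i = gamma j ^+ k * (V^T *m Z) j i.
Proof.
move=> VV hP.
have PV : P *m V = V *m diag_mx (\row_j gamma j).
  apply/matrixP => a b; rewrite mul_mx_diag [RHS]mxE mxE mulrC.
  have := congr1 (fun M : 'cV_n => M a 0) (hP b); rewrite !mxE => <-.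
  by apply: eq_bigr => l _; rewrite mxE.
have VP : V^T *m P = diag_mx (\row_j gamma j) *m V^T.
  rewrite -[LHS]mulmx1 -(mulmx1C VV) -mulmxA (mulmxA P) PV.
  by rewrite !mulmxA VV mul1mx.
elim: k => [|k IHk] /=; first by rewrite mul1r.
by rewrite mulmxA VP -mulmxA mul_diag_mx mxE IHk mxE mulrA -exprS.
Qed.

(** Convergence of subspace iteration. Choose the combination
    [y = X0 (V_p^T X0)^-1 e_i] of the starting columns: its leading coordinates in
    the eigenbasis are those of [e_i], its trailing ones are those of [E0 e_i].
    After [k] steps and division by [gamma_i ^+ k] the leading ones are unchanged,
    whereas the trailing ones have been multiplied by at most
    [(g / gamma_i) ^+ k]. The resulting vector lies in the iterated space, so its
    distance to [v_i] bounds that of the space.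

    The factor [M] says that the iterated space lies in the range of [X], and
    a projection onto a larger space leaves a smaller residual. *)
Lemma subspace_iteration_residual (R : realType) (n p k : nat)
    (hp : (p <= n)%N) (P V : 'M[R]_n) (gamma : 'I_n -> R) (g : R)
    (X0 X : 'M[R]_(n, p)) (M : 'M[R]_p) (i : 'I_p) :
  orthonormal_cols V -> (forall j, P *m col j V = gamma j *: col j V) ->
  0 < gamma (widen_ord hp i) -> 0 <= g ->
  (forall j : 'I_n, (p <= j)%N -> 0 <= gamma j <= g) ->
  (first_cols hp V)^T *m X0 \in unitmx ->
  orthonormal_cols X -> iter k (mulmx P) X0 = X *m M ->
  norm2 (col (widen_ord hp i) V - X *m (X^T *m col (widen_ord hp i) V))
  <= (g / gamma (widen_ord hp i)) ^+ k
     * specnorm ((last_cols hp V)^T *m X0 *m invmx ((first_cols hp V)^T *m X0)).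
Proof.
move=> VV hP gi0 g0 hg invX XX hX.
set E0 := _ *m invmx _; set v := col _ V.
set gi := gamma _ in gi0 *.
set W := invmx ((first_cols hp V)^T *m X0) in E0 *.
set e : 'cV[R]_p := delta_mx i 0.
have V'V' : orthonormal_cols V^T.
  by rewrite /orthonormal_cols trmxK; exact: mulmx1C.
(* On the basis X, these are the coordinates of P^k y / gi^k. *)
apply: le_trans (orth_residual_le v (gi ^- k *: (M *m (W *m e))) XX) _.
rewrite -scalemxAr mulmxA -hX.
have iterM (q : nat) (B : 'M[R]_(p, q)) :
    iter k (mulmx P) X0 *m B = iter k (mulmx P) (X0 *m B).
  by elim: (k) => //= l <-; rewrite mulmxA.
rewrite iterM mulmxA -(norm2_isometry _ V'V').
set y := X0 *m W *m e; set x := V^T *m _.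
have yhead (j : 'I_p) : (V^T *m y) (widen_ord hp j) 0 = (j == i)%:R.
  transitivity (((first_cols hp V)^T *m y) j 0).
    by rewrite !mxE; apply: eq_bigr => l _; rewrite !mxE.
  by rewrite /y !mulmxA mulmxV // mul1mx mxE eqxx andbT.
have ytail (j : 'I_(n - p)) :
    (V^T *m y) (cast_ord (subnKC hp) (rshift p j)) 0 = (E0 *m e) j 0.
  transitivity (((last_cols hp V)^T *m y) j 0).
    by rewrite !mxE; apply: eq_bigr => l _; rewrite !mxE.
  by rewrite /y /E0 !mulmxA.
have vE : V^T *m v = delta_mx (widen_ord hp i) 0.
  by rewrite /v colE mulmxA VV mul1mx.
have xE j : x j 0
    = (j == widen_ord hp i)%:R - (gamma j / gi) ^+ k * (V^T *m y) j 0.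
  have entry (c : R) (r t : 'cV[R]_n) : (r - c *: t) j 0 = r j 0 - c * t j 0.
    by rewrite !mxE.
  rewrite /x mulmxBr vE -scalemxAr entry.
  rewrite (eigencoord_iter _ _ _ _ VV hP) [delta_mx _ _ j 0]mxE eqxx andbT.
  by rewrite mulrA exprMn exprVn [gi ^- k * _]mulrC.
have xhead (j : 'I_p) : x (widen_ord hp j) 0 = 0.
  rewrite xE yhead; have [->|ji] := eqVneq j i.
    by rewrite eqxx divff ?gt_eqF // expr1n mulr1 subrr.
  by rewrite -(inj_eq val_inj) /= (inj_eq val_inj) (negPf ji) mulr0 subrr.
have xtail (j : 'I_(n - p)) (j' := cast_ord (subnKC hp) (rshift p j)) :
    x j' 0 = - ((gamma j' / gi) ^+ k * (E0 *m e) j 0).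
  rewrite xE ytail -(inj_eq val_inj) /= gtn_eqF ?sub0r //.
  exact: leq_trans (ltn_ord i) (leq_addr _ _).
have e1 : norm2 e = 1.
  by rewrite /norm2 innerE trmx_delta mul_delta_mx mxE !eqxx sqrtr1.
have q0 : 0 <= g / gi by rewrite divr_ge0 // ltW.
apply: (@le_trans _ _ ((g / gi) ^+ k * norm2 (E0 *m e))); last first.
  rewrite ler_wpM2l ?exprn_ge0 //.
  by have := norm2_mulmx_le E0 e; rewrite e1 mulr1.
rewrite -(ler_pXn2r (n := 2)) ?nnegrE ?mulr_ge0 ?exprn_ge0 ?norm2_ge0 //.
rewrite exprMn !norm2_sqr /inner (sum_widen_split hp).
rewrite big1 ?add0r => [|j _]; last by rewrite xhead mul0r.
rewrite mulr_sumr; apply: ler_sum => j _; rewrite xtail mulrNN -!expr2 exprMn.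
rewrite ler_wpM2r ?sqr_ge0 // ler_pXn2r ?nnegrE ?exprn_ge0 //.
  have /andP[gj0 gjg] := hg (cast_ord (subnKC hp) (rshift p j)) (leq_addr _ _).
  by rewrite lerXn2r ?nnegrE ?divr_ge0 ?ler_pM2r ?invr_gt0 // ltW.
by rewrite divr_ge0 ?(ltW gi0) //;
  have /andP[] := hg (cast_ord (subnKC hp) (rshift p j)) (leq_addr _ _).
Qed.

(** * Left singular vectors and singular values *)

(** Since [A] sends [v] to a multiple of [u] and [A^T] sends [u] back, removing the
    [u]-component commutes with [A]: the residual of [uh] on [u] is the image under
    [A] of the residual of [vh] on [v], divided by [s]. *)
Lemma left_vector_bound (R : realType) (m n : nat) (A : 'M[R]_(m, n))
    (s sigma : R) (u uh : 'cV[R]_m) (v vh : 'cV[R]_n) :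
  norm2 u = 1 -> norm2 v = 1 -> norm2 uh = 1 -> norm2 vh = 1 ->
  A *m v = sigma *: u -> A^T *m u = sigma *: v -> A *m vh = s *: uh -> 0 < s ->
  sin (angle uh u) <= specnorm A / s * sin (angle vh v).
Proof.
move=> u1 v1 uh1 vh1 Av Au Avh s0.
rewrite !sin_angle_residual //.
have -> : uh - inner u uh *: u = s^-1 *: (A *m (vh - inner v vh *: v)).
  have uhE : uh = s^-1 *: (A *m vh).
    by rewrite Avh scalerA mulVf ?scale1r // gt_eqF.
  have -> : inner u uh *: u = s^-1 *: (inner v vh *: (A *m v)).
    rewrite {1}uhE innerZr innerC inner_mulmxl Au innerZr Av !scalerA innerC.
    by congr (_ *: _); ring.
  by rewrite {1}uhE -scalerBr mulmxBr -scalemxAr.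
rewrite norm2Z ger0_norm ?invr_ge0 ?(ltW s0) //.
rewrite -mulrA mulrCA ler_pM2l ?invr_gt0 //.
exact: norm2_mulmx_le.
Qed.

Lemma singular_value_le_specnorm (R : realType) (m n : nat) (A : 'M[R]_(m, n))
    (sigma : R) (u : 'cV[R]_m) (v : 'cV[R]_n) :
  0 <= sigma -> norm2 u = 1 -> norm2 v = 1 -> A *m v = sigma *: u ->
  sigma <= specnorm A.
Proof.
move=> s0 u1 v1 Av; have := norm2_mulmx_le A v.
by rewrite Av norm2Z u1 v1 !mulr1 ger0_norm.
Qed.

(** With [vh = c v + z] and [z] orthogonal to [v], the vectors [A z] and [A v] are
    orthogonal as well, so that
    [s ^+ 2 - sigma ^+ 2 = norm2 (A z) ^+ 2 - sigma ^+ 2 * norm2 z ^+ 2]: a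
    difference of two numbers between [0] and [specnorm A ^+ 2 * norm2 z ^+ 2]. *)
Lemma ritz_value_bound (R : realType) (m n : nat) (A : 'M[R]_(m, n))
    (s sigma : R) (u uh : 'cV[R]_m) (v vh : 'cV[R]_n) :
  norm2 u = 1 -> norm2 v = 1 -> norm2 uh = 1 -> norm2 vh = 1 -> 0 <= sigma ->
  A *m v = sigma *: u -> A^T *m u = sigma *: v -> A *m vh = s *: uh ->
  `|s ^+ 2 - sigma ^+ 2| <= specnorm A ^+ 2 * sin (angle vh v) ^+ 2.
Proof.
move=> u1 v1 uh1 vh1 s0 Av Au Avh.
set c := inner v vh; set z := vh - c *: v.
have zz : inner z z = 1 - c ^+ 2.
  rewrite /z !(innerDl, innerDr, innerNl, innerNr, innerZl, innerZr).
  by rewrite (innerC vh v) -/c -!norm2_sqr v1 vh1; ring.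
have zv : inner z v = 0.
  by rewrite /z innerDl innerNl innerZl innerC -/c -norm2_sqr v1; ring.
have sinE : sin (angle vh v) ^+ 2 = inner z z.
  by rewrite sin_angle_residual // norm2_sqr.
have sE : s ^+ 2 = inner (A *m z) (A *m z) + c ^+ 2 * sigma ^+ 2.
  have -> : s ^+ 2 = inner (A *m vh) (A *m vh).
    by rewrite Avh innerZl innerZr -(norm2_sqr uh) uh1; ring.
  have -> : vh = z + c *: v by rewrite /z subrK.
  have AzAv : inner (A *m z) (A *m v) = 0.
    by rewrite inner_mulmxl Av -scalemxAr Au !innerZr zv !mulr0.
  rewrite mulmxDr -scalemxAr !(innerDl, innerDr, innerZl, innerZr).
  rewrite (innerC (A *m v) (A *m z)) AzAv Av innerZl innerZr.
  by rewrite -(norm2_sqr u) u1; ring.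
have Az : inner (A *m z) (A *m z) <= specnorm A ^+ 2 * inner z z.
  rewrite -!norm2_sqr -exprMn ler_pXn2r ?nnegrE ?mulr_ge0 ?norm2_ge0
    ?specnorm_ge0 //; exact: norm2_mulmx_le.
have sA : sigma ^+ 2 <= specnorm A ^+ 2.
  rewrite ler_pXn2r ?nnegrE ?specnorm_ge0 //.
  exact: singular_value_le_specnorm s0 u1 v1 Av.
have sz : sigma ^+ 2 * inner z z <= specnorm A ^+ 2 * inner z z.
  by rewrite ler_wpM2r ?inner_ge0.
have Az0 := inner_ge0 (A *m z).
have sz0 : 0 <= sigma ^+ 2 * inner z z by rewrite mulr_ge0 ?sqr_ge0 ?inner_ge0.
have -> : s ^+ 2 - sigma ^+ 2
    = inner (A *m z) (A *m z) - sigma ^+ 2 * inner z z.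
  by rewrite sE zz; ring.
rewrite sinE ler_norml; apply/andP; split; lra.
Qed.

(** * Eigenvalues of the approximate projector *)

Lemma horner_mx_eigenvector (R : realType) (n : nat) (B : 'M[R]_n.+1)
    (q : {poly R}) (lambda : R) (v : 'cV[R]_n.+1) :
  B *m v = lambda *: v -> horner_mx B q *m v = q.[lambda] *: v.
Proof.
move=> Bv; elim/poly_ind: q => [|q c IHq].
  by rewrite rmorph0 mul0mx horner0 scale0r.
rewrite rmorphD rmorphM /= horner_mx_X horner_mx_C mulmxDl -mulmxA Bv.
by rewrite -scalemxAr IHq mul_scalar_mx scalerA -scalerDl !hornerE mulrC.
Qed.

Lemma sigma_min_bounds (R : realType) (m n : nat) (A : 'M[R]_(m, n))
    (s : R) (u : 'cV[R]_m) (v : 'cV[R]_n) :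
  singular_triplet A s u v -> 0 <= sigma_min A <= s.
Proof.
move=> t; rewrite /sigma_min; set B := (X in inf X).
have Bs : B s by exists u, v.
have lbB : lbound B 0 by move=> r [u' [v' []]].
by apply/andP; split; [apply: lb_le_inf => //; exists s
  | apply: ge_inf => //; exists 0].
Qed.

Lemma cj_affineE (R : realType) (m n : nat) (A : 'M[R]_(m, n)) (x : R) :
  (cj_affine A).[x] = (2 * x - (specnorm A ^+ 2 + sigma_min A ^+ 2))
                      / (specnorm A ^+ 2 - sigma_min A ^+ 2).
Proof. by rewrite hornerZ hornerD hornerN hornerZ hornerX hornerC mulrC. Qed.

(** When [specnorm A = sigma_min A] the affine map has slope [0^-1 = 0] and is
    the zero polynomial, so the bounds survive this degenerate case. *)
Lemma cj_affine_bounds (R : realType) (m n : nat) (A : 'M[R]_(m, n)) (x : R) :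
  0 <= sigma_min A -> sigma_min A <= x -> x <= specnorm A ->
  -1 <= (cj_affine A).[x ^+ 2] <= 1.
Proof.
move=> s0 sx xN.
have hlo : sigma_min A ^+ 2 <= x ^+ 2.
  by rewrite ler_pXn2r ?nnegrE // (le_trans s0).
have hhi : x ^+ 2 <= specnorm A ^+ 2.
  by rewrite ler_pXn2r ?nnegrE // ?(le_trans s0) // (le_trans sx).
rewrite cj_affineE.
move: (specnorm A ^+ 2) (sigma_min A ^+ 2) (x ^+ 2) hlo hhi => N s y sy yN.
have [->|NE] := eqVneq N s; first by rewrite subrr invr0 mulr0 lerN10 ler01.
have sN : 0 < N - s.
  by rewrite subr_gt0 lt_neqAle eq_sym NE (le_trans sy).
rewrite ler_pdivlMr // ler_pdivrMr //; apply/andP; split; lra.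
Qed.

Lemma cj_affine_homo (R : realType) (m n : nat) (A : 'M[R]_(m, n)) (x y : R) :
  0 <= sigma_min A -> sigma_min A <= specnorm A -> x <= y ->
  (cj_affine A).[x] <= (cj_affine A).[y].
Proof.
move=> s0 sN xy; rewrite !cj_affineE.
apply: ler_wpM2r; last by lra.
rewrite invr_ge0 subr_ge0 ler_pXn2r ?nnegrE //; exact: le_trans sN.
Qed.

(** [l (sigma ^+ 2)] lies in the interval from [-1] to [1], hence is a cosine, and
    [acos] reverses the order of [l (a ^+ 2)] and [l (b ^+ 2)], so [cj_poly_ge0]
    applies to the eigenvalue [psi_d (l (sigma ^+ 2))]. *)
Lemma cj_eigenvalue_ge0 (R : realType) (m n d : nat) (A : 'M[R]_(m, n.+1))
    (a b s g : R) (u : 'cV[R]_m) (v : 'cV[R]_n.+1) :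
  sigma_min A <= a -> a <= b -> b <= specnorm A ->
  singular_triplet A s u v -> cj_projector A a b d *m v = g *: v -> 0 <= g.
Proof.
move=> sa ab bN t; have /andP[s0 ss] := sigma_min_bounds t.
have [sge0 u1 v1 Av Au] := t.
have sN := singular_value_le_specnorm sge0 u1 v1 Av.
have Sv : A^T *m A *m v = s ^+ 2 *: v.
  by rewrite -mulmxA Av -scalemxAr Au scalerA.
rewrite /cj_projector (horner_mx_eigenvector _ Sv) => /esym gE.
have -> : g = (cj_psi A a b d).[(cj_affine A).[s ^+ 2]].
  have v0 : v != 0.
    by apply/eqP => v0; move: v1; rewrite v0 /norm2 innerE mulmx0 mxE sqrtr0;
      move/eqP; rewrite eq_sym oner_eq0.
  rewrite -horner_comp; apply/eqP; rewrite -subr_eq0.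
  have /eqP : (g - (cj_psi A a b d \Po cj_affine A).[s ^+ 2]) *: v = 0.
    by rewrite scalerBl gE subrr.
  by rewrite scaler_eq0 (negPf v0) orbF.
have a0 : 0 <= a by apply: le_trans sa.
have /andP[la _] := cj_affine_bounds s0 sa (le_trans ab bN).
have /andP[_ lb] := cj_affine_bounds s0 (le_trans sa ab) bN.
have ls := cj_affine_bounds s0 ss sN.
rewrite -[(cj_affine A).[s ^+ 2]]acosK ?in_itv //.
apply: cj_poly_ge0; apply: acos_nonincreasing => //.
apply: cj_affine_homo => //; first exact: le_trans ss sN.
by rewrite ler_pXn2r ?nnegrE // (le_trans a0).
Qed.

(** * One step of the solver, and the convergence bounds *)

Lemma orthonormal_mul (R : realType) (m p q : nat) (Q : 'M[R]_(m, p))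
    (W : 'M[R]_(p, q)) :
  orthonormal_cols Q -> orthonormal_cols W -> orthonormal_cols (Q *m W).
Proof.
move=> QQ WW.
by rewrite /orthonormal_cols trmx_mul -mulmxA (mulmxA Q^T) QQ mul1mx.
Qed.

Lemma orth_projector_ontoE (R : realType) (n p : nat) (Pi : 'M[R]_n)
    (Q : 'M[R]_(n, p)) :
  orthonormal_cols Q -> orth_projector_onto Pi Q -> Pi = Q *m Q^T.
Proof.
move=> QQ [PT PP /andP[/submxP[C hC] /submxP[D hD]]].
have PQ : Pi *m Q = Q.
  by rewrite -[Q]trmxK hD trmx_mul trmxK mulmxA PP.
have QP : Q *m Q^T *m Pi = Pi.
  by rewrite -[Pi]trmxK hC trmx_mul trmxK mulmxA -(mulmxA Q) QQ mulmx1.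
by rewrite -[LHS]PT -{1}QP !trmx_mul trmxK PT mulmxA PQ.
Qed.

(** What the convergence theory needs from one pass of the solver. In the last
    clause the factors [R1] and [Vbar] are absorbed into [M]; that the columns of
    [P *m Vprev] lie in the new space is all that is remembered of them. *)
Lemma cj_feast_step_triplets (R : realType) (m n p : nat) (A : 'M[R]_(m, n))
    (P : 'M[R]_n) (Vprev Y Q1 : 'M[R]_(n, p)) (R1 : 'M[R]_p)
    (Q2 : 'M[R]_(m, p)) (Abar Ubar : 'M[R]_p) (shat : 'I_p -> R)
    (Vbar : 'M[R]_p) (Uhat : 'M[R]_(m, p)) (Vhat : 'M[R]_(n, p)) :
  cj_feast_step A P Vprev Y Q1 R1 Q2 Abar Ubar shat Vbar Uhat Vhat ->
  [/\ orthonormal_cols Uhat, orthonormal_cols Vhat,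
      A *m Vhat = Uhat *m diag_mx (\row_i shat i),
      Vhat *m Vhat^T = Q1 *m Q1^T & exists M, P *m Vprev = Vhat *m M].
Proof.
move=> [hY [hqr1 Q1o _] [hqr2 Q2o _] hsvd _ Uo Vo -> ->].
have VV : Vbar *m Vbar^T = 1%:M by apply: mulmx1C.
split; try exact: orthonormal_mul.
- by rewrite mulmxA hqr2 hsvd -!mulmxA Vo mulmx1.
- by rewrite trmx_mul mulmxA -(mulmxA Q1) VV mulmx1.
- exists (Vbar^T *m R1).
  by rewrite -mulmxA (mulmxA Vbar) VV mul1mx -hY.
Qed.

(* Indices are 0-based: sigma i, gamma i, col i V stand for
   sigma_(i+1), gamma_(i+1), v_(i+1), and the number of columns of A is n.+1. *)
Theorem theorem5p2 (R : realType) (m n : nat) (hmn : (n.+1 <= m)%N)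
  (A : 'M[R]_(m, n.+1))
  (a b : R) (hab : a <= b) (ha : sigma_min A <= a) (hb : b <= specnorm A)
  (d : nat)
  (sigma gamma : 'I_n.+1 -> R) (U : 'M[R]_(m, n.+1)) (V : 'M[R]_n.+1)
  (hsvd : svd_triplets A sigma U V)
  (hgamma : forall i, cj_projector A a b d *m col i V = gamma i *: col i V)
  (hgamma_mono : forall i j : 'I_n.+1, (i <= j)%N -> gamma j <= gamma i)
  (nsv p : nat)
  (hnsv : forall i : 'I_n.+1, (a <= sigma i <= b) <-> (i < nsv)%N)
  (hsimple : forall i j : 'I_n.+1,
     a <= sigma i <= b -> sigma j = sigma i -> j = i)
  (hnsvp : (nsv <= p)%N) (hp0 : (0 < p)%N) (hp : (p < n.+1)%N)
  (hgap : gamma (inord p) < gamma (inord p.-1))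
  (Vhat Y Q1 : nat -> 'M[R]_(n.+1, p)) (R1 : nat -> 'M[R]_p)
  (Q2 : nat -> 'M[R]_(m, p)) (Abar Ubar Vbar : nat -> 'M[R]_p)
  (shat : nat -> 'I_p -> R) (Uhat : nat -> 'M[R]_(m, p))
  (hV0 : orthonormal_cols (Vhat 0%N))
  (hV0inv : (first_cols (ltnW hp) V)^T *m Vhat 0%N \in unitmx)
  (hrun : forall k : nat, (0 < k)%N ->
     cj_feast_step A (cj_projector A a b d) (Vhat k.-1)
       (Y k) (Q1 k) (R1 k) (Q2 k) (Abar k) (Ubar k) (shat k) (Vbar k)
       (Uhat k) (Vhat k))
  (hlabel : forall k : nat, (0 < k)%N -> forall i j : 'I_p,
     sigma (widen_ord (ltnW hp) i) < sigma (widen_ord (ltnW hp) j) ->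
     shat k i <= shat k j)
  (Pk : nat -> 'M[R]_n.+1)
  (hPk : forall k : nat, (0 < k)%N -> orth_projector_onto (Pk k) (Q1 k)) :
  let E0 := (last_cols (ltnW hp) V)^T *m Vhat 0%N
              *m invmx ((first_cols (ltnW hp) V)^T *m Vhat 0%N) in
  let betak k := specnorm (Pk k *m (A^T *m A) *m (1%:M - Pk k)) in
  forall (k : nat) (i : 'I_p), (0 < k)%N -> (i < nsv)%N ->
  let i' := widen_ord (ltnW hp) i in
  let delta := ritz_gap (sigma i') (shat k) i in
  let sin_v := sin (angle (col i (Vhat k)) (col i' V)) in
  let sin_u := sin (angle (col i (Uhat k)) (col i' U)) in
  [/\ (0 < delta)%E ->
        sin_v <= Num.sqrt (1 + betak k ^+ 2 * fine ((delta ^+ 2)^-1)%E)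
                 * (gamma (inord p) / gamma i') ^+ k * specnorm E0,
      0 < shat k i -> sin_u <= specnorm A / shat k i * sin_v
    & `|shat k i ^+ 2 - sigma i' ^+ 2| <= specnorm A ^+ 2 * sin_v ^+ 2].
Proof.
move=> E0 betak k i k0 _ i' delta sin_v sin_u.
have [sigma0 UU VV AV AtU] := hsvd.
have [UhUh VhVh AVh VQ _] := cj_feast_step_triplets (hrun k k0).
have Q1o : orthonormal_cols (Q1 k) by have [_ []] := hrun k k0.
have v1 := norm2_col i' VV; have u1 := norm2_col i' UU.
have vh1 := norm2_col i VhVh; have uh1 := norm2_col i UhUh.
have Avh : A *m col i (Vhat k) = shat k i *: col i (Uhat k).
  rewrite colE mulmxA AVh -colE.
  by apply/colP => j; rewrite [LHS]mxE mul_mx_diag !mxE mulrC.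
split=> [delta0|s0|]; last 2 first.
- exact: left_vector_bound (AV i') (AtU i') Avh s0.
- exact: ritz_value_bound (sigma0 i') (AV i') (AtU i') Avh.
(* It remains to bound sin_v. Nonnegativity matters: a negative trailing
   eigenvalue of large modulus would dominate in the powers of P. *)
have gamma_ge0 j : 0 <= gamma j.
  have triplet : singular_triplet A (sigma j) (col j U) (col j V).
    by split; rewrite ?norm2_col.
  exact: cj_eigenvalue_ge0 ha hab hb triplet (hgamma j).
have gammai_gt0 : 0 < gamma i'.
  apply: le_lt_trans (gamma_ge0 (inord p)) _; apply: lt_le_trans hgap _.
  apply: hgamma_mono; rewrite inordK /=; last by rewrite prednK // ltnW.
  by rewrite -ltnS prednK.
(* The solver restarts from an orthonormal basis in each pass; up to the factor M
   this is plain subspace iteration from Vhat 0. *)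
have iterV l : exists M, iter l (mulmx (cj_projector A a b d)) (Vhat 0%N)
    = Vhat l *m M.
  elim: l => [|l [M IH]]; first by exists 1%:M; rewrite mulmx1.
  have [_ _ _ _ [M' hM']] := cj_feast_step_triplets (hrun l.+1 isT).
  by exists (M' *m M); rewrite /= IH mulmxA hM' mulmxA.
have [M hM] := iterV k.
have tail_le (j : 'I_n.+1) : (p <= j)%N -> 0 <= gamma j <= gamma (inord p).
  by move=> pj; rewrite gamma_ge0 hgamma_mono // inordK.
have residual := subspace_iteration_residual VV hgamma gammai_gt0
  (gamma_ge0 _) tail_le hV0inv VhVh hM.
have [f0 gapf] := ritz_gap_inv delta0.
have Sv : A^T *m A *m col i' V = sigma i' ^+ 2 *: col i' V.
  by rewrite -mulmxA AV -scalemxAr AtU scalerA.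
have rayleigh : (Vhat k)^T *m (A^T *m A) *m Vhat k
    = diag_mx (\row_j shat k j ^+ 2).
  rewrite -!mulmxA mulmxA -trmx_mul AVh trmx_mul mulmxA -(mulmxA _ (Uhat k)^T).
  rewrite UhUh mulmx1 tr_diag_mx.
  by apply/matrixP => j l; rewrite mul_diag_mx !mxE mulrnAr expr2.
have := ritz_vector_bound VhVh rayleigh v1 Sv f0 gapf (i := i).
rewrite VQ -(orth_projector_ontoE Q1o (hPk k k0)) => /le_trans; apply.
by rewrite -mulrA ler_wpM2l ?sqrtr_ge0.
Qed.
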